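(* Let $\mathscr A,\mathscr B$ be unital $C^*$-algebras, $\mathcal H$ a Hilbert space, and let $\Omega:\mathscr B\to B(\mathcal H)$ and $\Lambda:\mathscr A\to\mathscr B$ be completely positive maps. Let $(\pi,\mathcal K_\Omega,V)$ be a minimal Stinespring representation of $\Omega$ and $(\varphi,\mathcal L,S)$ a minimal Stinespring representation of $\pi\circ\Lambda:\mathscr A\to B(\mathcal K_\Omega)$. Let $\mathcal K_{\Omega,\Lambda}$, $Q_{\Omega,\Lambda}$, the lift $\Gamma_\Lambda^\Omega:\pi(\mathscr B)'\to\varphi(\mathscr A)'$ and the pullback transfer map $\mathcal T_\Lambda^\Omega:\pi(\mathscr B)'\to\rho(\mathscr A)'$ be as defined in the context. Then for $D\in\pi(\mathscr B)'$, $$D\in\operatorname{MD}(\mathcal T_\Lambda^\Omega)\iff \Gamma_\Lambda^\Omega(D)Q_{\Omega,\Lambda}=Q_{\Omega,\Lambda}\Gamma_\Lambda^\Omega(D).$$ Consequently, $$\operatorname{MD}(\mathcal T_\Lambda^\Omega)=\{D\in\pi(\mathscr B)':\ \Gamma_\Lambda^\Omega(D)Q_{\Omega,\Lambda}=Q_{\Omega,\Lambda}\Gamma_\Lambda^\Omega(D)\}.$$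
   Context: For completely positive maps, $\Phi\le\Psi$ means $\Psi-\Phi$ is completely positive. A Stinespring representation of a completely positive map $\Psi:\mathscr C\to B(\mathcal G)$ is a triple $(\sigma,\mathcal K,T)$ with $\sigma:\mathscr C\to B(\mathcal K)$ a unital $*$-representation, $T:\mathcal G\to\mathcal K$ bounded and $\Psi(C)=T^*\sigma(C)T$; it is minimal if $\mathcal K=\overline{\operatorname{span}}\{\sigma(C)T\xi\}$. Radon--Nikodym theorem (known): if $(\sigma,\mathcal K,T)$ is minimal and $\Phi$ is completely positive with $\Phi\le c\Psi$ for some $c\ge0$, there is a unique positive $E\in\sigma(\mathscr C)'$ with $\Phi(C)=T^*\sigma(C)ET$ for all $C$; it is denoted $\frac{\mathrm d\Phi}{\mathrm d\Psi}$. Setting: $\Omega(B)=V^*\pi(B)V$ and $\pi(\Lambda(A))=S^*\varphi(A)S$ are the minimal Stinespring representations on $\mathcal K_\Omega$ and $\mathcal L$. Put $\mathcal K_{\Omega,\Lambda}=\overline{\operatorname{span}}\{\varphi(A)SV\xi:A\in\mathscr A,\xi\in\mathcal H\}\subseteq\mathcal L$, which reduces $\varphi(\mathscr A)$; let $Q_{\Omega,\Lambda}$ be the orthogonal projection of $\mathcal L$ onto it, $\rho(A)=\varphi(A)|_{\mathcal K_{\Omega,\Lambda}}$ and $W=SV$. Then $(\rho,\mathcal K_{\Omega,\Lambda},W)$ is a minimal Stinespring representation of $\Omega\circ\Lambda$. Lift: for $D\in\pi(\mathscr B)'$, $\Gamma_\Lambda^\Omega(D)\in\varphi(\mathscr A)'$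 is the unique bounded operator with $\Gamma_\Lambda^\Omega(D)\varphi(A)S\eta=\varphi(A)SD\eta$ for all $A\in\mathscr A$, $\eta\in\mathcal K_\Omega$; $\Gamma_\Lambda^\Omega$ is a unital $*$-homomorphism. Pullback transfer map: for positive $D\in\pi(\mathscr B)'$ let $\Omega_D(B)=V^*\pi(B)DV$, and let $\mathcal T_\Lambda^\Omega(D)=\frac{\mathrm d(\Omega_D\circ\Lambda)}{\mathrm d(\Omega\circ\Lambda)}\in\rho(\mathscr A)'$, computed in $(\rho,\mathcal K_{\Omega,\Lambda},W)$; $\mathcal T_\Lambda^\Omega$ is extended linearly to $\pi(\mathscr B)'$, and is unital completely positive. Multiplicative domain of a unital completely positive map $\Theta$: $\operatorname{MD}(\Theta)=\{X:\Theta(X^*X)=\Theta(X)^*\Theta(X)\text{ and }\Theta(XX^* )=\Theta(X)\Theta(X)^*\}$. *)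

(* Defs.v *)
From HB Require Import structures.
From mathcomp Require Import all_boot all_order all_algebra.
From mathcomp Require Import complex.
From mathcomp Require Import all_classical all_reals topology normedtype.
From mathcomp Require Import ring lra.

Set Implicit Arguments.
Unset Strict Implicit.
Unset Printing Implicit Defensive.

Import Order.TTheory GRing.Theory Num.Theory.
Import numFieldNormedType.Exports.

Local Open Scope classical_set_scope.
Local Open Scope complex_scope.
Local Open Scope ring_scope.

Reserved Notation "''B' ( H , K )" (at level 8, format "''B' ( H ,  K )").
Reserved Notation "''B' ( H )" (at level 8, format "''B' ( H )").
Reserved Notation "x ** y" (at level 40, left associativity).
Reserved Notation "f ∘ g" (at level 40, left associativity).

HB.mixin Record isHilbert (R : realType) H of CompleteNormedModule R[i] H := {
  inner : H -> H -> R[i];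
  inner_linear : forall z, scalar (inner ^~ z);
  innerC : forall x y, inner x y = (inner y x)^*;
  inner_norm : forall x, inner x x = `|x| ^+ 2 }.

#[short(type="hilbertType")]
HB.structure Definition Hilbert (R : realType) :=
  { H of CompleteNormedModule R[i] H & isHilbert R H }.

(* The product and unit are not taken from GRing.PzRing, because
   Hierarchy-Builder has no join of PzRing with Lmodule (resp. with a norm)
   outside nontrivial rings (resp. numDomainType). *)
HB.mixin Record isStarAlgebra (R : realType) A of GRing.Lmodule R[i] A := {
  amul : A -> A -> A;
  aone : A;
  star : A -> A;
  amulA : associative amul;
  amul1x : left_id aone amul;
  amulx1 : right_id aone amul;
  amul_linearl : forall y, linear (amul ^~ y);
  amul_linearr : forall x, linear (amul x);
  starK : involutive star;
  starM : forall x y, star (amul x y) = amul (star y) (star x);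
  star_conj_linear : forall (a : R[i]) x y,
    star (a *: x + y) = a^* *: star x + star y }.

#[short(type="starAlgType")]
HB.structure Definition StarAlgebra (R : realType) :=
  { A of GRing.Lmodule R[i] A & isStarAlgebra R A }.

Notation "x ** y" := (amul x y) : ring_scope.

HB.mixin Record isCStarAlgebra (R : realType) A
    of StarAlgebra R A & CompleteNormedModule R[i] A := {
  cstar_normM : forall x y : A, `|x ** y| <= `|x| * `|y|;
  cstar_norm : forall x : A, `|star x ** x| = `|x| ^+ 2 }.

#[short(type="cstarAlgType")]
HB.structure Definition CStarAlgebra (R : realType) :=
  { A of StarAlgebra R A & CompleteNormedModule R[i] A & isCStarAlgebra R A }.


Section BoundedOperators.
Variables (R : realType) (H K : hilbertType R).

Definition bounded_linear (f : H -> K) : Prop :=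
  linear f /\ exists c : R[i], forall x, `|f x| <= c * `|x|.

Definition bounded_linear_pred : {pred H -> K} := fun f => `[< bounded_linear f >].

Record bop := Bop { bop_fun :> H -> K; _ : bop_fun \in bounded_linear_pred }.

HB.instance Definition _ := [isSub for bop_fun].
HB.instance Definition _ := [Choice of bop by <:].

Lemma bounded_linear_submod : submod_closed bounded_linear_pred.
Proof.
split.
  apply/asboolP; split; first by move=> a x y; rewrite scaler0 addr0.
  by exists 0 => x; rewrite normr0 mul0r.
move=> a f g /asboolP[lf [c hc]] /asboolP[lg [d hd]]; apply/asboolP; split.
  move=> b x y; rewrite -[LHS]/(a *: f _ + g _).
  rewrite -[RHS]/(b *: (a *: f x + g x) + (a *: f y + g y)).
  by rewrite lf lg !scalerDr !scalerA (mulrC a b) addrACA.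
exists (`|a| * c + d) => x.
rewrite (le_trans (ler_normD _ _))// mulrDl lerD//.
by rewrite normrZ -mulrA ler_wpM2l.
Qed.

HB.instance Definition _ :=
  GRing.isSubmodClosed.Build R[i] (H -> K) bounded_linear_pred bounded_linear_submod.
HB.instance Definition _ := [SubChoice_isSubLmodule of bop by <:].

Lemma bop_bounded_linear (f : bop) : bounded_linear f.
Proof. by case: f => f /= /asboolP. Qed.

Lemma bopP (f g : bop) : f =1 g -> f = g.
Proof. by move=> fg; apply/val_inj/funext. Qed.

HB.instance Definition _ (f : bop) :=
  GRing.isLinear.Build R[i] H K *:%R f (bop_bounded_linear f).1.

Definition mkbop (f : H -> K) (hf : bounded_linear f) : bop :=
  @Bop f (asboolT hf).

End BoundedOperators.

Notation "''B' ( H , K )" := (bop H K) : type_scope.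
Notation "''B' ( H )" := (bop H H) : type_scope.

Section BopTheory.
Variable R : realType.
Implicit Types H K : hilbertType R.

Lemma bopDE H K (f g : 'B(H, K)) x : (f + g) x = f x + g x.
Proof. by []. Qed.

Lemma bopZE H K (a : R[i]) (f : 'B(H, K)) x : (a *: f) x = a *: f x.
Proof. by []. Qed.

Lemma bop_bound H K (f : 'B(H, K)) :
  exists2 c : R[i], 0 <= c & forall x, `|f x| <= c * `|x|.
Proof.
have [_ [c hc]] := bop_bounded_linear f; exists `|c| => // x.
rewrite -[`|x|]normr_id -normrM ger0_norm//.
by rewrite (le_trans _ (hc x)).
Qed.

Lemma bop_id_subproof H : bounded_linear (@id H).
Proof. by split=> //; exists 1 => x; rewrite mul1r. Qed.

Definition bop_id H : 'B(H) := mkbop (bop_id_subproof H).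

Lemma bop_comp_subproof H K L (f : 'B(K, L)) (g : 'B(H, K)) :
  bounded_linear (f \o g).
Proof.
split; first by move=> a x y /=; rewrite !linearP.
have [c c0 hc] := bop_bound f; have [d d0 hd] := bop_bound g.
by exists (c * d) => x; rewrite (le_trans (hc _))// -mulrA ler_wpM2l.
Qed.

Definition bop_comp H K L (f : 'B(K, L)) (g : 'B(H, K)) : 'B(H, L) :=
  mkbop (bop_comp_subproof f g).

End BopTheory.

Notation "f ∘ g" := (bop_comp f g) : ring_scope.

Section InnerTheory.
Variables (R : realType) (H : hilbertType R).
Implicit Types x y z : H.

Lemma innerDl x y z : inner (x + y) z = inner x z + inner y z.
Proof. by have := inner_linear z 1 x y; rewrite scale1r mul1r. Qed.

Lemma inner0l z : inner (0 : H) z = 0.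
Proof. by apply: (@addIr _ (inner 0 z)); rewrite -innerDl !add0r. Qed.

Lemma innerZl a x z : inner (a *: x) z = a * inner x z.
Proof. by have := inner_linear z a x 0; rewrite inner0l !addr0. Qed.

Lemma innerNl x z : inner (- x) z = - inner x z.
Proof. by rewrite -scaleN1r innerZl mulN1r. Qed.

Lemma innerBl x y z : inner (x - y) z = inner x z - inner y z.
Proof. by rewrite innerDl innerNl. Qed.

Lemma innerDr x y z : inner z (x + y) = inner z x + inner z y.
Proof. by rewrite innerC innerDl rmorphD/= -!innerC. Qed.

Lemma inner0r z : inner z (0 : H) = 0.
Proof. by rewrite innerC inner0l rmorph0. Qed.

Lemma innerZr a x z : inner z (a *: x) = Num.conj a * inner z x.
Proof. by rewrite innerC innerZl rmorphM/= -innerC. Qed.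

Lemma innerNr x z : inner z (- x) = - inner z x.
Proof. by rewrite innerC innerNl rmorphN/= -innerC. Qed.

Lemma innerBr x y z : inner z (x - y) = inner z x - inner z y.
Proof. by rewrite innerDr innerNr. Qed.

Lemma inner_ext x y : (forall z, inner x z = inner y z) -> x = y.
Proof.
move=> xy; apply/eqP; rewrite -subr_eq0 -normr_eq0 -sqrf_eq0 -inner_norm.
by rewrite innerBl xy subrr.
Qed.

Lemma inner_extr x y : (forall z, inner z x = inner z y) -> x = y.
Proof. by move=> xy; apply: inner_ext => z; rewrite innerC xy -innerC. Qed.

Lemma norm_proj x y : y != 0 ->
  `|x - (inner x y / `|y| ^+ 2) *: y| ^+ 2 =
  `|x| ^+ 2 - `|inner x y| ^+ 2 / `|y| ^+ 2.
Proof.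
move=> y0; have ny : `|y| ^+ 2 != 0 by rewrite sqrf_eq0 normr_eq0.
have nyc : Num.conj (`|y| ^+ 2) = `|y| ^+ 2.
  by apply/CrealP; rewrite realX// normr_real.
rewrite -!inner_norm innerBl !innerBr !innerZl !innerZr !inner_norm.
rewrite fmorph_div/= nyc (innerC y x) normCK.
by rewrite divfK// subrr subr0; congr (_ - _); rewrite mulrC mulrA.
Qed.

Lemma cauchy_schwarz x y : `|inner x y| <= `|x| * `|y|.
Proof.
have [->|y0] := eqVneq y 0; first by rewrite inner0r !normr0 mulr0.
have ny : 0 < `|y| ^+ 2 by rewrite exprn_gt0// normr_gt0.
rewrite -ler_sqr ?nnegrE ?mulr_ge0// exprMn -ler_pdivrMr// -subr_ge0.
by rewrite -norm_proj// exprn_ge0.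
Qed.

Lemma parallelogram x y :
  `|x + y| ^+ 2 + `|x - y| ^+ 2 = 2 * `|x| ^+ 2 + 2 * `|y| ^+ 2.
Proof.
rewrite -!inner_norm !innerDl !innerDr !innerNl !innerNr; ring.
Qed.

End InnerTheory.

Record csub (R : realType) (H : hilbertType R) := CSub {
  cset : set H;
  cset0 : cset 0;
  csetP : forall (a : R[i]) x y, cset x -> cset y -> cset (a *: x + y);
  cset_closed : closed cset }.

Section Closure.
Variables (R : realType) (H : hilbertType R).

Lemma closure_normP (A : set H) x :
  closure A x <-> forall e : R[i], 0 < e -> exists2 y, A y & `|x - y| < e.
Proof.
split.
  move=> + e e0 => /(_ (ball x e) (nbhsx_ballx _ _ e0))[y [Ay]].
  by rewrite -ball_normE /= => xy; exists y.
move=> h B /nbhs_ballP[e /= e0 xB]; have [y Ay xy] := h e e0.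
by exists y; split=> //; apply: xB; rewrite -ball_normE.
Qed.

Lemma closure_linear (A : set H) :
  (forall (a : R[i]) x y, A x -> A y -> A (a *: x + y)) ->
  forall (a : R[i]) x y, closure A x -> closure A y -> closure A (a *: x + y).
Proof.
move=> hA a x y /closure_normP hx /closure_normP hy; apply/closure_normP => e e0.
have a1 : 0 < `|a| + 1 by rewrite ltr_wpDl.
have e2 : 0 < e / 2 by rewrite divr_gt0.
have [x' Ax' xx'] := hx _ (divr_gt0 e2 a1).
have [y' Ay' yy'] := hy _ e2.
exists (a *: x' + y'); first exact: hA.
rewrite opprD addrACA -scalerBr (le_lt_trans (ler_normD _ _))//.
rewrite (splitr e) ler_ltD// normrZ; move: xx'; rewrite ltr_pdivlMr// => /ltW.
apply: le_trans; rewrite mulrC ler_wpM2l// lerDl//.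
Qed.

End Closure.

Section Projection.
Variables (R : realType) (H : hilbertType R) (M : csub H).

Let N (x : H) : R := complex.Re `|x|.

Let NE x : `|x| = (N x)%:C.
Proof. by rewrite /N RRe_real// normr_real. Qed.

Let N_ge0 x : 0 <= N x.
Proof. by rewrite -ler0c -NE. Qed.

Let N_tri x y : N (x + y) <= N x + N y.
Proof. by rewrite -lecR rmorphD/= -!NE ler_normD. Qed.

Let N_par x y : N (x + y) ^+ 2 + N (x - y) ^+ 2 = 2 * N x ^+ 2 + 2 * N y ^+ 2.
Proof.
apply: (@complexI R); have := parallelogram x y.
by rewrite !NE !(rmorphD, rmorphM, rmorphXn, rmorph_nat) /=.
Qed.

Let NZ (a : R) x : N (a%:C *: x) = `|a| * N x.
Proof.
apply: (@complexI R); rewrite -NE normrZ rmorphM/= -NE; congr (_ * _).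
by rewrite normc_def /= expr0n/= addr0 sqrtr_sqr.
Qed.

Lemma cset_proj_exists x :
  exists p, cset M p /\ forall y, cset M y -> inner (x - p) y = 0.
Proof.
pose E := [set N (x - y) | y in cset M].
have E_inf : has_inf E.
  split; first by exists (N (x - 0)); exists 0 => //; exact: cset0.
  by exists 0 => _ [y _ <-].
pose d := inf E.
have d_le y : cset M y -> d <= N (x - y).
  by move=> My; apply: (ge_inf E_inf.2); exists y.
have d0 : 0 <= d by apply: lb_le_inf E_inf.1 _ => _ [y _ <-].
pose B (e : R) := [set y | cset M y /\ N (x - y) < d + e].
pose F := filter_from [set e : R | 0 < e] B.
have FF : Filter F.
  apply: filter_from_filter; first by exists 1 => /=.
  move=> i j /= i0 j0; exists (Num.min i j); first by rewrite /= lt_min i0.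
  move=> y [My yl]; split; split=> //; apply: (lt_le_trans yl).
    by rewrite lerD2l ge_min lexx.
  by rewrite lerD2l ge_min lexx orbT.
have FP : ProperFilter F.
  apply: filter_from_proper => e /= e0.
  have [_ [y My <-] yl] := inf_adherent e0 E_inf.
  by exists y.
have close e y z : 0 < e -> B e y -> B e z -> N (y - z) ^+ 2 < 8 * d * e + 4 * e ^+ 2.
  move=> e0 [My yl] [Mz zl].
  have := N_par (x - y) (x - z).
  have -> : x - y - (x - z) = - (y - z) by rewrite opprB addrC addrA subrK opprB.
  have -> : N (- (y - z)) = N (y - z) by rewrite /N normrN.
  have -> : x - y + (x - z) = 2%:C *: (x - 2^-1%:C *: (y + z)).
    rewrite scalerBr scalerA -rmorphM/= divff ?pnatr_eq0// scale1r.
    by rewrite rmorph_nat scaler_nat mulr2n addrACA -opprD.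
  rewrite NZ ger0_norm//.
  have : d <= N (x - 2^-1%:C *: (y + z)).
    apply: d_le; rewrite scalerDr; apply: csetP => //.
    by rewrite -[_ *: z]addr0; apply: csetP => //; exact: cset0.
  move: yl zl; move: (N_ge0 (x - y)) (N_ge0 (x - z)).
  move: (N (x - y)) (N (x - z)) (N (y - z)) (N (x - 2^-1%:C *: (y + z))) => a b c m.
  move=> a0 b0 al bl dm eq.
  have : a ^+ 2 < (d + e) ^+ 2 by rewrite ltrXn2r//.
  have : b ^+ 2 < (d + e) ^+ 2 by rewrite ltrXn2r//.
  have : d ^+ 2 <= m ^+ 2 by rewrite lerXn2r// nnegrE// (le_trans d0).
  by nra.
have Fc : cauchy F.
  apply: cauchy_exP => eps eps0.
  have [r r0 er] : exists2 r : R, 0 < r & eps = r%:C.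
    have er : (complex.Re eps)%:C = eps by rewrite RRe_real// gtr0_real.
    by exists (complex.Re eps); rewrite -?ltcR er.
  pose e := Num.min 1 (r ^+ 2 / (8 * d + 4)).
  have D0 : 0 < 8 * d + 4 by lra.
  have e0 : 0 < e by rewrite lt_min ltr01 divr_gt0// exprn_gt0.
  have e1 : e <= 1 by rewrite ge_min lexx.
  have e2 : e * (8 * d + 4) <= r ^+ 2.
    by rewrite -ler_pdivlMr// ge_min lexx orbT.
  have [_ [y My <-] yl] := inf_adherent e0 E_inf.
  exists y; exists e => // z Bz; rewrite -ball_normE /= NE er ltcR.
  have h := close _ y z e0 (conj My yl) Bz.
  rewrite -(@ltr_pXn2r _ 2) ?nnegrE ?(ltW r0)//.
  apply: (lt_le_trans h); move: e0 e1 e2; clearbody e; clear; nra.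
have /cvg_ex[l Fl] := @cauchy_cvg H F FP Fc.
have Ml : cset M l.
  have FM : F (cset M) by exists 1 => [/=|y []//].
  exact: (@closed_cvg _ _ F _ id (cset M) (@cset_closed _ _ M) FM).
have Nl : N (x - l) <= d.
  apply/ler_addgt0Pr => e e0.
  have e20 : 0 < e / 2 by rewrite divr_gt0.
  have : \forall y \near F, `|l - y| < (e / 2)%:C.
    by apply: cvgr_dist_lt => //; rewrite ltcR.
  have FB : F (B (e / 2)) by exists (e / 2).
  move=> /(filterI FB)/filter_ex[y [[My yl] ly]].
  have ly' : N (y - l) < e / 2.
    by rewrite -ltcR -NE distrC.
  have := N_tri (x - y) (y - l); rewrite addrA subrK => h.
  by move: yl ly' h; lra.
exists l; split=> // y My.
have [->|y0] := eqVneq y 0; first by rewrite inner0r.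
pose a := inner (x - l) y / `|y| ^+ 2.
have : `|x - l| ^+ 2 <= `|x - l - a *: y| ^+ 2.
  rewrite lerXn2r ?nnegrE// !NE lecR (le_trans Nl)//.
  have -> : x - l - a *: y = x - (a *: y + l) by rewrite opprD addrA addrAC.
  exact/d_le/csetP.
rewrite norm_proj// lerBrDr gerDl => h.
have ny : 0 < `|y| ^+ 2 by rewrite exprn_gt0// normr_gt0.
apply/eqP; rewrite -normr_eq0 -sqrf_eq0 eq_le exprn_ge0// andbT.
by move: h; rewrite pmulr_lle0// invr_gt0.
Qed.

End Projection.

Section Orthoproj.
Variables (R : realType) (H : hilbertType R) (M : csub H).

Let p x : H := sval (cid (cset_proj_exists M x)).

Let pM x : cset M (p x).
Proof. by rewrite /p; case: cid => y []. Qed.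

Let pO x y : cset M y -> inner (x - p x) y = 0.
Proof. by move: y; rewrite /p; case: (cid _) => z /= []. Qed.

Lemma cset_add x y : cset M x -> cset M y -> cset M (x + y).
Proof. by move=> Mx My; rewrite -[x]scale1r; exact: csetP. Qed.

Lemma cset_scale (a : R[i]) x : cset M x -> cset M (a *: x).
Proof. by move=> Mx; rewrite -[_ *: x]addr0; apply: csetP => //; exact: cset0. Qed.

Lemma cset_sub x y : cset M x -> cset M y -> cset M (x - y).
Proof. by move=> Mx My; rewrite -scaleN1r; apply: cset_add => //; exact: cset_scale. Qed.

Let p_uniq x q : cset M q -> (forall y, cset M y -> inner (x - q) y = 0) -> p x = q.
Proof.
move=> Mq hq; apply/eqP; rewrite -subr_eq0 -normr_eq0 -sqrf_eq0 -inner_norm.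
have Mpq : cset M (p x - q) by apply: cset_sub.
have e : p x - q = (x - q) - (x - p x) by rewrite opprB [RHS]addrC addrA subrK.
by rewrite {1}e innerBl hq// pO// subrr.
Qed.

Lemma oproj_subproof : bounded_linear p.
Proof.
split.
  move=> a x y; apply: p_uniq; first by apply: csetP.
  move=> z Mz; rewrite opprD addrACA -scalerBr innerDl innerZl !pO//.
  by rewrite mulr0 addr0.
exists 1 => x; rewrite mul1r -ler_sqr ?nnegrE// -!inner_norm.
have : inner (x - p x + p x) (x - p x + p x) =
    inner (x - p x) (x - p x) + inner (p x) (p x).
  rewrite innerDl !(innerDr (x - p x) (p x)) [inner (p x) (x - p x)]innerC !(pO _ (pM x)).
  by rewrite rmorph0 addr0 add0r.
by rewrite subrK => ->; rewrite lerDr inner_norm exprn_ge0.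
Qed.

Definition oproj : 'B(H) := mkbop oproj_subproof.

Lemma oproj_in x : cset M (oproj x). Proof. exact: pM. Qed.

Lemma oproj_ortho x y : cset M y -> inner (x - oproj x) y = 0.
Proof. exact: pO. Qed.

Lemma oproj_id x : cset M x -> oproj x = x.
Proof. by move=> Mx; apply: p_uniq => // y _; rewrite subrr inner0l. Qed.

End Orthoproj.

Section Adjoint.
Variable R : realType.
Implicit Types H K : hilbertType R.

Lemma riesz H (f : H -> R[i]) : scalar f ->
  (exists2 c, 0 <= c & forall x, `|f x| <= c * `|x|) ->
  exists z, forall x, f x = inner x z.
Proof.
move=> lf [c c0 hc].
have fD x y : f (x + y) = f x + f y by have := lf 1 x y; rewrite scale1r mul1r.
have f0 : f 0 = 0 by apply: (@addIr _ (f 0)); rewrite -fD !add0r.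
have fZ a x : f (a *: x) = a * f x by have := lf a x 0; rewrite f0 !addr0.
have fB x y : f (x - y) = f x - f y by rewrite fD -scaleN1r fZ mulN1r.
have [[x0 fx0]|nf] := pselect (exists x, f x != 0); last first.
  exists 0 => x; rewrite inner0r; apply/eqP; apply: contrapT => /negP fx.
  by apply: nf; exists x.
have kerP (a : R[i]) x y : f x = 0 -> f y = 0 -> f (a *: x + y) = 0.
  by move=> fx fy; rewrite lf fx fy mulr0 addr0.
have kerC : closed [set x | f x = 0].
  move=> x /closure_normP hx /=; apply/eqP/negP => /negP fx.
  have c1 : 0 < c + 1 by rewrite ltr_wpDl.
  have fx' : 0 < `|f x| by rewrite normr_gt0.
  have [y /= fy] := hx _ (divr_gt0 fx' c1).
  rewrite ltr_pdivlMr// => h; have := hc (x - y).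
  rewrite fB fy subr0 => /le_lt_trans /(_ _) h'.
  suff /h' : c * `|x - y| < `|f x| by rewrite ltxx.
  by apply: le_lt_trans h; rewrite mulrC ler_wpM2l// lerDl.
pose M := @CSub R H [set x | f x = 0] f0 kerP kerC.
pose u := x0 - oproj M x0.
have fu : f u = f x0 by rewrite fB (oproj_in M x0) subr0.
have u0 : u != 0 by apply: contraNneq fx0 => u0; rewrite -fu u0 f0.
have nu : `|u| ^+ 2 != 0 by rewrite sqrf_eq0 normr_eq0.
exists (Num.conj (f u / `|u| ^+ 2) *: u) => x.
have : inner u (x - (f x / f u) *: u) = 0.
  by apply: (oproj_ortho (M := M)); rewrite /= fB fZ divfK ?subrr// fu.
move=> /(congr1 Num.conj); rewrite rmorph0/= -innerC innerBl innerZl inner_norm.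
move=> /eqP; rewrite subr_eq0 => /eqP xu.
by rewrite innerZr conjCK xu mulrCA divfK// divfK// fu.
Qed.

Lemma adj_exists H K (f : 'B(H, K)) :
  exists g : 'B(K, H), forall x y, inner (f x) y = inner x (g y).
Proof.
have [c c0 hc] := bop_bound f.
have ex y : exists z, forall x, inner (f x) y = inner x z.
  apply: riesz; first by move=> a x x' /=; rewrite linearP innerDl innerZl.
  exists (c * `|y|); first by rewrite mulr_ge0.
  move=> x; rewrite (le_trans (cauchy_schwarz _ _))// mulrAC.
  by rewrite ler_wpM2r.
have [g hg] := choice ex.
have bg : bounded_linear g.
  split.
    move=> a y z; apply: inner_extr => x.
    by rewrite -hg !innerDr !innerZr -!hg.
  exists c => y; have [->|gy0] := eqVneq (g y) 0.
    by rewrite normr0 mulr_ge0.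
  have gy : 0 < `|g y| by rewrite normr_gt0.
  rewrite -(ler_pM2l gy) -expr2 -inner_norm -hg.
  rewrite -[leLHS]ger0_norm; last by rewrite hg inner_norm exprn_ge0.
  rewrite (le_trans (cauchy_schwarz _ _))// mulrA ler_wpM2r//.
  by rewrite mulrC.
by exists (mkbop bg).
Qed.

Definition adj H K (f : 'B(H, K)) : 'B(K, H) := sval (cid (adj_exists f)).

Lemma adjE H K (f : 'B(H, K)) x y : inner (f x) y = inner x (adj f y).
Proof. by rewrite /adj; case: cid. Qed.

Lemma adjE' H K (f : 'B(H, K)) x y : inner (adj f x) y = inner x (f y).
Proof. by rewrite innerC -adjE -innerC. Qed.

Lemma adj_uniq H K (f : 'B(H, K)) (g : 'B(K, H)) :
  (forall x y, inner (f x) y = inner x (g y)) -> adj f = g.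
Proof. by move=> h; apply: bopP => y; apply: inner_extr => x; rewrite -adjE h. Qed.

Lemma adjK H K (f : 'B(H, K)) : adj (adj f) = f.
Proof. by apply: adj_uniq => x y; rewrite adjE'. Qed.

Lemma adj_comp H K L (f : 'B(K, L)) (g : 'B(H, K)) :
  adj (f ∘ g) = adj g ∘ adj f.
Proof. by apply: adj_uniq => x y /=; rewrite !adjE. Qed.

Lemma adj_conj_linear H K (a : R[i]) (f g : 'B(H, K)) :
  adj (a *: f + g) = Num.conj a *: adj f + adj g.
Proof.
apply: adj_uniq => x y; rewrite !bopDE !bopZE innerDl innerDr innerZl innerZr.
by rewrite conjCK !adjE.
Qed.

End Adjoint.

Section BopStarAlgebra.
Variables (R : realType) (H : hilbertType R).
Implicit Types f g h : 'B(H).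

Let compA : associative (@bop_comp R H H H).
Proof. by move=> f g h; apply: bopP. Qed.
Let comp1x : left_id (bop_id H) (@bop_comp R H H H).
Proof. by move=> f; apply: bopP. Qed.
Let compx1 : right_id (bop_id H) (@bop_comp R H H H).
Proof. by move=> f; apply: bopP. Qed.
Let comp_linearl g : linear (fun f => f ∘ g).
Proof. by move=> a f f'; apply: bopP. Qed.
Let comp_linearr f : linear (fun g => f ∘ g).
Proof. by move=> a g g'; apply: bopP => x /=; rewrite linearP. Qed.

HB.instance Definition _ := @isStarAlgebra.Build R 'B(H) (@bop_comp R H H H)
  (bop_id H) (@adj R H H) compA comp1x compx1 comp_linearl comp_linearr
  (@adjK R H H) (@adj_comp R H H H) (@adj_conj_linear R H H).

End BopStarAlgebra.

Section ClosedSpan.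
Variables (R : realType) (H : hilbertType R) (G : set H).

Definition span : set H :=
  [set x | exists2 s : seq (R[i] * H),
     (forall p, p \in s -> G p.2) & x = \sum_(p <- s) p.1 *: p.2].

Lemma span0 : span 0.
Proof. by exists [::] => //; rewrite big_nil. Qed.

Lemma span_linear (a : R[i]) x y : span x -> span y -> span (a *: x + y).
Proof.
move=> [s hs ->] [t ht ->].
exists ([seq (a * p.1, p.2) | p <- s] ++ t).
  by move=> p; rewrite mem_cat => /orP[/mapP[q /hs Gq ->]|/ht].
rewrite big_cat big_map/= scaler_sumr; congr (_ + _).
by apply: eq_bigr => p _; rewrite scalerA.
Qed.

Definition closed_span : csub H :=
  @CSub R H (closure span) (subset_closure span0)
    (closure_linear span_linear) (@closed_closure _ span).

Lemma closed_span_incl x : G x -> cset closed_span x.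
Proof.
move=> Gx; apply: subset_closure; exists [:: (1, x)].
  by move=> p; rewrite inE => /eqP ->.
by rewrite big_seq1 scale1r.
Qed.

Lemma closed_span_stable (T : 'B(H)) : (forall x, G x -> G (T x)) ->
  forall x, cset closed_span x -> cset closed_span (T x).
Proof.
move=> GT x /closure_normP hx; apply/closure_normP => e e0.
have [c c0 hc] := bop_bound T; have c1 : 0 < c + 1 by rewrite ltr_wpDl.
have [_ [s sG ->] xy] := hx _ (divr_gt0 e0 c1).
exists (T (\sum_(p <- s) p.1 *: p.2)).
  exists [seq (p.1, T p.2) | p <- s].
    by move=> _ /mapP[p ps ->]; apply/GT/sG.
  by rewrite linear_sum big_map; apply: eq_bigr => p _; rewrite linearZ_LR.
rewrite -linearB (le_lt_trans (hc _))//; move: xy; rewrite ltr_pdivlMr//.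
by apply: le_lt_trans; rewrite mulrC ler_wpM2l// lerDl.
Qed.

End ClosedSpan.

Section SubHilbert.
Variables (R : realType) (H : hilbertType R) (M : csub H).

Definition csub_pred : {pred H} := fun x => `[< cset M x >].

Record csub_type := CsubElt { csub_val :> H; _ : csub_val \in csub_pred }.

HB.instance Definition _ := [isSub for csub_val].
HB.instance Definition _ := [Choice of csub_type by <:].

Lemma csub_submod : submod_closed csub_pred.
Proof.
split; first by apply/asboolP; exact: cset0.
by move=> a x y /asboolP Mx /asboolP My; apply/asboolP/csetP.
Qed.

HB.instance Definition _ :=
  GRing.isSubmodClosed.Build R[i] H csub_pred csub_submod.
HB.instance Definition _ := [SubChoice_isSubLmodule of csub_type by <:].

Lemma csub_valP (x : csub_type) : cset M (csub_val x).
Proof. by case: x => x /= /asboolP. Qed.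

Definition mkcsub (x : H) (Mx : cset M x) : csub_type := CsubElt (asboolT Mx).

Let norm (x : csub_type) : R[i] := `|csub_val x|.

Let norm_tri x y : norm (x + y) <= norm x + norm y.
Proof. exact: ler_normD. Qed.
Let normZ (a : R[i]) x : norm (a *: x) = `|a| * norm x.
Proof. exact: normrZ. Qed.
Let norm_eq0 x : norm x = 0 -> x = 0.
Proof. by move=> /normr0_eq0 x0; apply: val_inj. Qed.

HB.instance Definition _ :=
  Lmodule_isNormed.Build R[i] csub_type norm_tri normZ norm_eq0.

Let complete (F : set_system csub_type) : ProperFilter F -> cauchy F -> cvg F.
Proof.
move=> FF /cauchyP Fc.
pose F' := csub_val @ F.
have F'c : cauchy F'.
  apply: cauchy_exP => e /Fc[x Fx]; exists (csub_val x).
  rewrite /F' /fmap /= nbhs_simpl; apply: filterS Fx => y.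
  by rewrite /= -!ball_normE.
have F'P : ProperFilter F' by exact: fmap_proper_filter.
have /cvg_ex[l F'l] := @cauchy_cvg H F' F'P F'c.
have Ml : cset M l.
  have FM : F' (cset M) by apply: (@filterE _ F) => x; exact: csub_valP.
  exact: (@closed_cvg _ _ F' _ id (cset M) (@cset_closed _ _ M) FM).
apply/cvg_ex; exists (mkcsub Ml); apply/cvgrPdist_lt => e e0.
by have /cvgrPdist_lt/(_ _ e0) := F'l.
Qed.

HB.instance Definition _ := Uniform_isComplete.Build csub_type complete.

Let inn (x y : csub_type) : R[i] := inner (csub_val x) (csub_val y).
Let inn_linear z : scalar (inn ^~ z).
Proof. by move=> a x y; rewrite /inn/= innerDl innerZl. Qed.
Let innC x y : inn x y = Num.conj (inn y x).
Proof. exact: innerC. Qed.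
Let inn_norm x : inn x x = `|x| ^+ 2.
Proof. exact: inner_norm. Qed.

HB.instance Definition _ :=
  isHilbert.Build R csub_type inn_linear innC inn_norm.

End SubHilbert.

Section Restriction.
Variable R : realType.
Implicit Types H L : hilbertType R.

(* T|_M as an operator on M; junk value 0 when M is not invariant under T *)
Definition restrict L (M : csub L) (T : 'B(L)) : 'B(csub_type M) :=
  xget (0 : 'B(csub_type M))
    [set T' : 'B(csub_type M) | forall x : csub_type M, csub_val (T' x) = T (csub_val x)].

(* T with codomain M; junk value 0 when the range of T is not contained in M *)
Definition corestrict H L (M : csub L) (T : 'B(H, L)) : 'B(H, csub_type M) :=
  xget (0 : 'B(H, csub_type M))
    [set T' : 'B(H, csub_type M) | forall x, csub_val (T' x) = T x].

Lemma restrictE L (M : csub L) (T : 'B(L)) :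
  (forall x, cset M x -> cset M (T x)) ->
  forall x, csub_val (restrict M T x) = T (csub_val x).
Proof.
move=> TM.
pose f x := mkcsub (TM _ (csub_valP x)).
have hf : bounded_linear f.
  split; first by move=> a x y; apply: val_inj; rewrite /= linearP.
  by have [c _ hc] := bop_bound T; exists c => x; exact: hc.
by rewrite /restrict; case: xgetP => [T' _ //|/(_ (mkbop hf))[]].
Qed.

Lemma corestrictE H L (M : csub L) (T : 'B(H, L)) :
  (forall x, cset M (T x)) -> forall x, csub_val (corestrict M T x) = T x.
Proof.
move=> TM.
pose f x := mkcsub (TM x).
have hf : bounded_linear f.
  split; first by move=> a x y; apply: val_inj; rewrite /= linearP.
  by have [c _ hc] := bop_bound T; exists c => x; exact: hc.
by rewrite /corestrict; case: xgetP => [T' _ //|/(_ (mkbop hf))[]].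
Qed.

End Restriction.

Section CompletePositivity.
Variables (R : realType) (A B : starAlgType R).

Definition positive (x : A) : Prop := exists y : A, x = star y ** y.

(* X is the product in M_n(A) of the conjugate transpose of Y with Y *)
Definition positive_mx n (X : 'M[A]_n) : Prop :=
  exists Y : 'M[A]_n, X = \matrix_(i, j) \sum_(k < n) star (Y k i) ** Y k j.

Definition commutant (S : set A) : set A :=
  [set X | forall Y, S Y -> X ** Y = Y ** X].

(* multiplicative domain of Th : P -> B, where P is a *-subalgebra of A *)
Definition MD (P : set A) (Th : A -> B) : set A :=
  [set X | [/\ P X, Th (star X ** X) = star (Th X) ** Th X
             & Th (X ** star X) = Th X ** star (Th X)]].

End CompletePositivity.

Definition completely_positive (R : realType) (A B : starAlgType R)
    (Phi : {linear A -> B}) : Prop :=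
  forall n (X : 'M[A]_n), positive_mx X -> positive_mx (map_mx Phi X).

Section Stinespring.
Variables (R : realType) (C : starAlgType R) (G K : hilbertType R).

Record representation (sigma : C -> 'B(K)) : Prop := Representation {
  rep_linear : linear sigma;
  rep_mul : forall x y, sigma (x ** y) = sigma x ** sigma y;
  rep_one : sigma aone = aone;
  rep_star : forall x, sigma (star x) = star (sigma x) }.

Record minimal_stinespring (Psi : C -> 'B(G)) (sigma : C -> 'B(K))
    (T : 'B(G, K)) : Prop := MinimalStinespring {
  stinespring_rep : representation sigma;
  stinespringE : forall c, Psi c = adj T ∘ sigma c ∘ T;
  stinespring_minimal :
    cset (closed_span [set y | exists c xi, y = sigma c (T xi)]) = setT }.

(* E = dPhi/dPsi, computed in a minimal Stinespring representation
   (sigma, K, T) of Psi *)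
Definition radon_nikodym (sigma : C -> 'B(K)) (T : 'B(G, K))
    (Phi : C -> 'B(G)) (E : 'B(K)) : Prop :=
  [/\ positive E, commutant (range sigma) E
    & forall c, Phi c = adj T ∘ sigma c ∘ E ∘ T].

End Stinespring.

Section Transfer.
Variables (R : realType) (A B : cstarAlgType R) (H KO L : hilbertType R).
Variables (Lambda : A -> B) (pi : B -> 'B(KO)) (V : 'B(H, KO)).
Variables (phi : A -> 'B(L)) (S : 'B(KO, L)).

Definition K_OL : csub L :=
  closed_span [set y | exists a xi, y = phi a (S (V xi))].

Definition Q_OL : 'B(L) := oproj K_OL.

Definition rho (a : A) : 'B(csub_type K_OL) := restrict K_OL (phi a).

Definition W_OL : 'B(H, csub_type K_OL) := corestrict K_OL (S ∘ V).

Lemma rhoE : representation phi ->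
  forall a x, csub_val (rho a x) = phi a (csub_val x).
Proof.
move=> rphi a; apply/restrictE/closed_span_stable => _ [b [xi ->]].
by exists (a ** b), xi; rewrite (rep_mul rphi).
Qed.

Lemma W_OLE : representation phi -> forall xi, csub_val (W_OL xi) = S (V xi).
Proof.
move=> rphi; apply/corestrictE => xi; apply: closed_span_incl.
by exists aone, xi; rewrite (rep_one rphi).
Qed.

(* Gamma is the lift; its values off pi(B)' are irrelevant. Minimality of
   (phi, L, S) gives uniqueness, and membership in phi(A)' is automatic. *)
Definition is_lift (Gamma : 'B(KO) -> 'B(L)) : Prop :=
  forall D, commutant (range pi) D ->
  forall a eta, Gamma D (phi a (S eta)) = phi a (S (D eta)).

Definition Omega_ (D : 'B(KO)) (b : B) : 'B(H) := adj V ∘ pi b ∘ D ∘ V.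

(* T is the linear map on pi(B)' that extends the Radon-Nikodym derivatives;
   its values off pi(B)' are irrelevant. *)
Definition is_transfer (T : 'B(KO) -> 'B(csub_type K_OL)) : Prop :=
  (forall (a : R[i]) D E, commutant (range pi) D -> commutant (range pi) E ->
     T (a *: D + E) = a *: T D + T E) /\
  (forall D, commutant (range pi) D -> positive D ->
     radon_nikodym rho W_OL (Omega_ D \o Lambda) (T D)).

End Transfer.

(* Main.v *)
Require Import Defs.
From HB Require Import structures.
From mathcomp Require Import all_boot all_order all_algebra.
From mathcomp Require Import complex.
From mathcomp Require Import all_classical all_reals topology normedtype.
From mathcomp Require Import ring.

(* Let [J] be the inclusion of [K_OL] in [L], so that [Q = J J^*]. Comparing
   matrix coefficients on the vectors [phi(A) S V H] identifies the transfer map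
   with the compressed lift, [T(D) = J^* Gamma(D) J]. As [Gamma] is a
   star-homomorphism, [T(D^* D) - T(D)^* T(D) = X^* X] with
   [X = (1 - Q) Gamma(D) J]; hence [D] is in the multiplicative domain iff
   [Gamma(D)] and its adjoint both map [K_OL] into itself. *)

Set Implicit Arguments.
Unset Strict Implicit.
Unset Printing Implicit Defensive.

Import Order.TTheory GRing.Theory Num.Theory.

Local Open Scope classical_set_scope.
Local Open Scope ring_scope.

(** * Testing vectors and operators on a closed span *)

Section Density.
Context {R : realType}.
Implicit Types H K : hilbertType R.

(** A finite combination [u] of generators is orthogonal to [y], so Cauchy-Schwarz bounds the
    coefficient by [|x - u| |y|], which can be made arbitrarily small. *)
Lemma closed_span_ortho H (G : set H) y :
  (forall g, G g -> inner g y = 0) ->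
  forall x, cset (closed_span G) x -> inner x y = 0.
Proof.
move=> Gy x /closure_normP hx; apply/eqP; rewrite -normr_le0.
apply/ler_addgt0Pl => e e0; rewrite addr0.
(* The added 1 keeps the divisor positive when [y = 0]. *)
have y1 : 0 < `|y| + 1 by rewrite ltr_wpDl.
have [_ [s sG ->]] := hx _ (divr_gt0 e0 y1).
set u := (X in x - X) => xu.
have uy : inner u y = 0.
  rewrite /u; elim: s sG {u xu} => [|p s IHs] sG; first by rewrite big_nil inner0l.
  rewrite big_cons innerDl innerZl Gy ?mulr0 ?add0r; last by apply: sG; rewrite mem_head.
  by apply: IHs => q qs; apply: sG; rewrite inE qs orbT.
rewrite -[inner x y]subr0 -uy -innerBl (le_trans (cauchy_schwarz _ _))//.
move: xu; rewrite ltr_pdivlMr// => /ltW; apply: le_trans.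
by rewrite ler_wpM2l// lerDl.
Qed.

(** Passing to adjoints turns the claim into orthogonality of [x] to [adj f z - adj g z], which can
    be checked on generators. *)
Lemma bop_closed_span H K (f g : 'B(H, K)) (G : set H) :
  (forall x, G x -> f x = g x) ->
  forall x, cset (closed_span G) x -> f x = g x.
Proof.
move=> fg x Gx; apply: inner_ext => z; rewrite !adjE.
apply/eqP; rewrite -subr_eq0 -innerBr; apply/eqP.
apply: closed_span_ortho Gx => y Gy.
by rewrite innerBr -!adjE fg// subrr.
Qed.

End Density.

Arguments oproj : simpl never.

(** * Compression to a closed subspace, and reducing subspaces *)

Section Compression.
Context {R : realType} {L : hilbertType R} (M : csub L).

Lemma incl_subproof : bounded_linear (csub_val (M := M)).
Proof. by split=> //; exists 1 => x; rewrite mul1r. Qed.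

Definition incl : 'B(csub_type M, L) := mkbop incl_subproof.

Definition compress (G : 'B(L)) : 'B(csub_type M) := adj incl ∘ G ∘ incl.

Lemma inner_oproj x y : cset M y -> inner (oproj M x) y = inner x y.
Proof.
move=> My; apply/esym/eqP; rewrite -subr_eq0 -innerBl; apply/eqP.
exact: oproj_ortho.
Qed.

Lemma adj_oproj : adj (oproj M) = oproj M.
Proof.
apply: adj_uniq => x y.
rewrite -(inner_oproj x (oproj_in M y)) innerC -inner_oproj -?innerC //.
exact: oproj_in.
Qed.

(** This is [Q = J J^*]: both vectors lie in [M] and have the same inner products with [M]. *)
Lemma adj_incl x : csub_val (adj incl x) = oproj M x.
Proof.
pose p : csub_type M := mkcsub (oproj_in M x).
suff -> : adj incl x = p by [].
apply: inner_ext => z; rewrite adjE'.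
by rewrite -[RHS]/(inner (oproj M x) (csub_val z)) inner_oproj//; exact: csub_valP.
Qed.

Lemma adj_inclK x : adj incl (csub_val x) = x.
Proof. by apply: val_inj; rewrite /= adj_incl oproj_id//; exact: csub_valP. Qed.

Lemma compressE G x : csub_val (compress G x) = oproj M (G (csub_val x)).
Proof. by rewrite adj_incl. Qed.

Lemma adj_compress G : adj (compress G) = compress (adj G).
Proof. by rewrite /compress !adj_comp adjK; apply: bopP. Qed.

Lemma compress_linear : linear compress.
Proof. by move=> a F G; apply: bopP => x; rewrite /= !linearP. Qed.

(** On the diagonal the two sides differ by the squared distance from [G x] to [M], so equality
    forces [G x] into [M]. Conversely, invariance lets the projection between [adj G] and [G] drop
    out. *)
Lemma compress_mul (G : 'B(L)) :
  compress (adj G ∘ G) = adj (compress G) ∘ compress G <->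
  forall x, cset M x -> cset M (G x).
Proof.
have defect x : inner (compress (adj G ∘ G) x - (adj (compress G) ∘ compress G) x) x
    = `|G (csub_val x) - oproj M (G (csub_val x))| ^+ 2.
  set u := G (csub_val x).
  have Quu : inner (oproj M u) u = inner (oproj M u) (oproj M u).
    by rewrite !(adjE (oproj M)) adj_oproj (oproj_id (oproj_in M u)).
  rewrite -inner_norm [RHS]innerBr [X in _ = _ - X]oproj_ortho ?subr0; last exact: oproj_in.
  rewrite !innerBl Quu; congr (_ - _); first by rewrite /= !adjE'.
  rewrite -[LHS]/(inner (adj (compress G) (compress G x)) x) adjE'.
  by rewrite -[LHS]/(inner (csub_val _) (csub_val _)) compressE.
split=> [cG x Mx|GM].
  move: (defect (mkcsub Mx)); rewrite cG subrr inner0l => /esym/eqP.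
  rewrite sqrf_eq0 normr_eq0 subr_eq0 => /eqP ->; exact: oproj_in.
apply: bopP => x; apply: inner_ext => y.
rewrite -[RHS]/(inner (adj (compress G) (compress G x)) y) adjE'.
rewrite -[RHS]/(inner (csub_val _) (csub_val _)) !compressE.
rewrite !oproj_id; [|exact/GM/csub_valP..].
by rewrite /= !adjE'.
Qed.

(** With [Q] the projection, invariance under [G] is [Q G Q = G Q], and invariance under [adj G] is,
    after taking adjoints, [Q G Q = Q G]. *)
Lemma reducesP (G : 'B(L)) :
  G ∘ oproj M = oproj M ∘ G <->
  (forall x, cset M x -> cset M (G x)) /\ (forall x, cset M x -> cset M (adj G x)).
Proof.
split=> [GQ|[GM G'M]].
  split=> x Mx.
    have : (G ∘ oproj M) x = (oproj M ∘ G) x by rewrite GQ.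
    rewrite -[LHS]/(G (oproj M x)) oproj_id// => ->.
    exact: oproj_in.
  have : adj (oproj M ∘ G) x = adj (G ∘ oproj M) x by rewrite GQ.
  rewrite !adj_comp adj_oproj -[LHS]/(adj G (oproj M x)) oproj_id// => ->.
  exact: oproj_in.
apply: bopP => x; apply: inner_ext => y.
rewrite -[(G ∘ _) x]/(G (oproj M x)) -[(oproj M ∘ G) x]/(oproj M (G x)).
have <- : oproj M (G (oproj M x)) = G (oproj M x).
  by rewrite oproj_id//; apply/GM/oproj_in.
rewrite !(adjE (oproj M)) adj_oproj !(adjE G) adjE adj_oproj oproj_id//.
exact/G'M/oproj_in.
Qed.

End Compression.

(** * The commutant of a representation, generated linearly by its squares *)

Section Commutant.
Context {R : realType} {C : starAlgType R} {K : hilbertType R}.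
Context (sigma : C -> 'B(K)) (rep : representation sigma).
Implicit Types D E : 'B(K).

Lemma commutantE D :
  commutant (range sigma) D <-> forall c x, D (sigma c x) = sigma c (D x).
Proof.
split=> [h c x|h Y [c _ <-]]; last by apply: bopP => x; exact: h.
have /(congr1 (fun f : 'B(K) => f x)) : D ** sigma c = sigma c ** D by apply: h; exists c.
exact.
Qed.

Lemma commutant_lin a D E : commutant (range sigma) D ->
  commutant (range sigma) E -> commutant (range sigma) (a *: D + E).
Proof.
move=> /commutantE cD /commutantE cE; apply/commutantE => c x.
by rewrite !bopDE !bopZE cD cE linearP.
Qed.

Lemma commutant1 : commutant (range sigma) (aone : 'B(K)).
Proof. exact/commutantE. Qed.

Lemma commutantM D E : commutant (range sigma) D ->
  commutant (range sigma) E -> commutant (range sigma) (D ∘ E).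
Proof. by move=> /commutantE cD /commutantE cE; apply/commutantE => c x /=; rewrite cE cD. Qed.

Lemma rep_inner c x y : inner (sigma c x) y = inner x (sigma (star c) y).
Proof. by rewrite (rep_star rep) -adjE. Qed.

(** The range of [sigma] is closed under adjoints, so the adjoint of the relation for [star c] is
    the relation for [c]. *)
Lemma commutant_adj D : commutant (range sigma) D -> commutant (range sigma) (adj D).
Proof.
move=> /commutantE cD; apply/commutantE => c x; apply: inner_extr => y.
by rewrite -adjE -(starK c) -!rep_inner -adjE cD.
Qed.

(* Polarization: with [X'] the adjoint of [X], [2 D = (D' + D) - i ((i D)' + i D)]
   and [X' + X = (1 + X)' (1 + X) - X' X - 1]. *)
Lemma commutant_ind (P : set 'B(K)) :
  (forall a D E, P D -> P E -> P (a *: D + E)) ->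
  (forall X, commutant (range sigma) X -> P (adj X ∘ X)) ->
  forall D, commutant (range sigma) D -> P D.
Proof.
move=> lP sqP.
have reP X : commutant (range sigma) X -> P (adj X + X).
  move=> cX.
  have c1X : commutant (range sigma) (1 *: aone + X).
    exact: commutant_lin commutant1 cX.
  have -> : adj X + X = (-1) *: (adj aone ∘ aone)
      + ((-1) *: (adj X ∘ X) + (adj (1 *: aone + X) ∘ (1 *: aone + X))).
    rewrite !scale1r; apply: bopP => x; apply: inner_ext => y.
    rewrite !bopDE !bopZE !innerDl !innerZl /= !adjE' /=.
    by rewrite !innerDl !innerDr; ring.
  exact: (lP _ _ _ (sqP _ commutant1) (lP _ _ _ (sqP _ cX) (sqP _ c1X))).
move=> D cD.
(* Closure under [a *: D + E] gives a lone scalar multiple only once [P 0] is known; zero arises as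
   [- Y + Y]. *)
have P0 : P 0.
  by have := lP (-1) _ _ (reP _ cD) (reP _ cD); rewrite scaleN1r addNr.
have ciD : commutant (range sigma) ('i *: D).
  by rewrite -[_ *: D]addr0; apply: commutant_lin => //; apply/commutantE => c x; rewrite linear0.
have -> : D = (- 'i / 2) *: (adj ('i *: D) + 'i *: D) + (2^-1 *: (adj D + D) + 0).
  rewrite addr0; apply: bopP => x; apply: inner_ext => y.
  rewrite !bopDE !bopZE !innerDl !innerZl !bopDE !innerDl !adjE' !bopZE innerZr innerZl conjCi.
  have i2 : 'i * 'i = -1 :> R[i] by rewrite -expr2 sqrCi.
  by field: i2.
exact: (lP _ _ _ (reP _ ciD) (lP _ _ _ (reP _ cD) P0)).
Qed.

End Commutant.

(** * The lift as a star-homomorphism, and the transfer map as its compression *)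

Section Lift.
Context {R : realType} {A B : cstarAlgType R} {H KO L : hilbertType R}.
Context {Lambda : {linear A -> B}} { pi : B -> 'B(KO)} {V : 'B(H, KO)}.
Context {phi : A -> 'B(L)} {S : 'B(KO, L)} {Gamma : 'B(KO) -> 'B(L)}.
Context (pi_rep : representation pi).
Context (st_phi : minimal_stinespring (pi \o Lambda) phi S).
Context (lift_Gamma : is_lift pi phi S Gamma).
Implicit Types D E : 'B(KO).

Let phi_rep := stinespring_rep st_phi.

Lemma stinespring_ext K (f g : 'B(L, K)) :
  (forall a eta, f (phi a (S eta)) = g (phi a (S eta))) -> f = g.
Proof.
move=> fg; apply: bopP => x.
apply: (bop_closed_span (G := [set y | exists a eta, y = phi a (S eta)])).
  by move=> _ [a [eta ->]].
by rewrite (stinespring_minimal st_phi).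
Qed.

Lemma stinespring_inner_ext u v :
  (forall a eta, inner (phi a (S eta)) u = inner (phi a (S eta)) v) -> u = v.
Proof.
move=> uv; apply: inner_extr => z; apply/eqP; rewrite -subr_eq0 -innerBr; apply/eqP.
apply: (closed_span_ortho (G := [set y | exists a eta, y = phi a (S eta)])).
  by move=> _ [a [eta ->]]; rewrite innerBr uv subrr.
by rewrite (stinespring_minimal st_phi).
Qed.

(** Moving [phi b] to the left leaves [S^* phi(b^* a) S], which the Stinespring formula evaluates;
    coefficients in [L] thereby become coefficients in [KO]. *)
Lemma stinespring_inner a b x y :
  inner (phi a (S x)) (phi b (S y)) = inner (pi (Lambda (star b ** a)) x) y.
Proof.
rewrite -[pi _]/((pi \o Lambda) _) (stinespringE st_phi) /= adjE' /=.
by rewrite (rep_mul phi_rep) /= [RHS](rep_inner phi_rep) starK.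
Qed.

Lemma lift_linear a D E : commutant (range pi) D -> commutant (range pi) E ->
  Gamma (a *: D + E) = a *: Gamma D + Gamma E.
Proof.
move=> cD cE; apply: stinespring_ext => c eta.
rewrite lift_Gamma; last exact: commutant_lin.
by rewrite !bopDE !bopZE !lift_Gamma// !linearP.
Qed.

Lemma lift_comp D E : commutant (range pi) D -> commutant (range pi) E ->
  Gamma (D ∘ E) = Gamma D ∘ Gamma E.
Proof.
move=> cD cE; apply: stinespring_ext => c eta.
by rewrite lift_Gamma /= ?lift_Gamma//; exact: commutantM.
Qed.

(** Between generating vectors both sides reduce to coefficients of some [pi (Lambda c)], with [D]
    applied after it on one side and before it on the other; [D] commutes with it. *)
Lemma lift_adj D : commutant (range pi) D -> Gamma (adj D) = adj (Gamma D).
Proof.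
move=> cD; apply: stinespring_ext => a x.
apply: stinespring_inner_ext => b z.
rewrite lift_Gamma; last exact: (commutant_adj pi_rep).
rewrite -adjE lift_Gamma// !stinespring_inner.
by rewrite -adjE; move/commutantE: cD => ->.
Qed.

Context (T : 'B(KO) -> 'B(csub_type (K_OL V phi S))).
Context (transfer_T : is_transfer Lambda pi T).

(* For positive [D] both sides have the matrix coefficients
   [<Omega_D(Lambda(b^* a)) xi, eta>] between [phi(a) S V xi] and [phi(b) S V eta]. *)
Lemma transfer_compress D : commutant (range pi) D ->
  T D = compress (K_OL V phi S) (Gamma D).
Proof.
have [T_lin T_rn] := transfer_T.
(* Membership in the commutant is part of [P] because [T] and [Gamma] are known to be linear only
   there. *)
move=> cD; pose P := [set D | commutant (range pi) D /\ T D = compress (K_OL V phi S) (Gamma D)].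
suff [] : P D by [].
apply: (@commutant_ind _ _ _ pi P) cD => [a E F [cE TE] [cF TF]|X cX].
  split; first exact: commutant_lin.
  by rewrite T_lin// TE TF lift_linear// compress_linear.
have cXX : commutant (range pi) (adj X ∘ X).
  by apply: commutantM => //; exact: (commutant_adj pi_rep).
split=> //; move: cXX; set D' := adj X ∘ X => cD'.
have [_ cT TE] : radon_nikodym (rho V phi S) (W_OL V phi S) (Omega_ pi V D' \o Lambda) (T D').
  by apply: T_rn => //; exists X.
have K_in a xi : cset (K_OL V phi S) (phi a (S (V xi))).
  by apply: closed_span_incl; exists a, xi.
have rho_W a xi : csub_val (rho V phi S a (W_OL V phi S xi)) = phi a (S (V xi)).
  by rewrite rhoE// W_OLE.
have coef a b xi eta :
    inner (csub_val (T D' (rho V phi S a (W_OL V phi S xi)))) (phi b (S (V eta))) =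
    inner (Gamma D' (phi a (S (V xi)))) (phi b (S (V eta))).
  rewrite lift_Gamma// stinespring_inner.
  have := congr1 (fun f : 'B(H) => inner (f xi) eta) (TE (star b ** a)).
  rewrite /= adjE' /= => ->; rewrite adjE' -[RHS]/(inner (csub_val _) (csub_val _)).
  rewrite rhoE// W_OLE// (rep_mul phi_rep) /= (rep_star phi_rep) adjE'.
  by rewrite -rhoE//; move/commutantE: cT => <-.
(* The generators live in [L], so both operators are extended to [L] by precomposing with
   [adj incl], which undoes the inclusion. *)
apply: bopP => x; rewrite -[x]adj_inclK.
apply: (@bop_closed_span _ _ _ (T D' ∘ adj (incl _)) (compress _ _ ∘ adj (incl _))
  _ _ _ (csub_valP x)) => _ [a [xi ->]].
rewrite -rho_W /= adj_inclK; apply: val_inj => /=; rewrite adj_incl rho_W.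
(* The difference [d] lies in [K_OL] and, by [coef], is orthogonal to its generators, hence to
   itself. *)
set u := csub_val _; set w := Gamma _ _; pose d := u - oproj (K_OL V phi S) w.
apply/eqP; rewrite -subr_eq0 -/d -normr_eq0 -sqrf_eq0 -inner_norm; apply/eqP.
apply: (closed_span_ortho (G := [set y | exists a xi, y = phi a (S (V xi))])) => [_ [b [eta ->]]|].
  by rewrite innerC innerBl inner_oproj// coef subrr rmorph0.
by apply: cset_sub; [exact: csub_valP|exact: oproj_in].
Qed.

End Lift.

Theorem theorem3p6 (R : realType) (A B : cstarAlgType R)
    (H KO L : hilbertType R)
    (Omega : {linear B -> 'B(H)}) (Lambda : {linear A -> B})
    (cpOmega : completely_positive Omega)
    (cpLambda : completely_positive Lambda)
    (pi : B -> 'B(KO)) (V : 'B(H, KO))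
    (st_pi : minimal_stinespring Omega pi V)
    (phi : A -> 'B(L)) (S : 'B(KO, L))
    (st_phi : minimal_stinespring (pi \o Lambda) phi S)
    (Gamma : 'B(KO) -> 'B(L)) (lift_Gamma : is_lift pi phi S Gamma)
    (T : 'B(KO) -> 'B(csub_type (K_OL V phi S)))
    (transfer_T : is_transfer Lambda pi T) :
  (forall D, commutant (range pi) D ->
     (MD (commutant (range pi)) T D <->
      Gamma D ∘ Q_OL V phi S = Q_OL V phi S ∘ Gamma D)) /\
  MD (commutant (range pi)) T =
    [set D | commutant (range pi) D /\
             Gamma D ∘ Q_OL V phi S = Q_OL V phi S ∘ Gamma D].
Proof.
have pi_rep := stinespring_rep st_pi.
have TE := transfer_compress pi_rep st_phi lift_Gamma transfer_T.
have MDP D : commutant (range pi) D ->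
    (MD (commutant (range pi)) T D <->
     Gamma D ∘ Q_OL V phi S = Q_OL V phi S ∘ Gamma D).
  move=> cD; have cD' := commutant_adj pi_rep cD.
  have cDD : commutant (range pi) (adj D ∘ D) by exact: commutantM.
  have cDD' : commutant (range pi) (D ∘ adj D) by exact: commutantM.
  have eqDD : T (adj D ∘ D) = adj (T D) ∘ T D <->
      forall x, cset (K_OL V phi S) x -> cset (K_OL V phi S) (Gamma D x).
    rewrite !TE// (lift_comp st_phi lift_Gamma)//.
    by rewrite (lift_adj pi_rep st_phi lift_Gamma)// compress_mul.
  have eqDD' : T (D ∘ adj D) = T D ∘ adj (T D) <->
      forall x, cset (K_OL V phi S) x -> cset (K_OL V phi S) (adj (Gamma D) x).
    rewrite !TE// (lift_comp st_phi lift_Gamma)//.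
    rewrite (lift_adj pi_rep st_phi lift_Gamma)//.
    (* This is [compress_mul] for the operator [adj (Gamma D)]. *)
    by rewrite -compress_mul -adj_compress !adjK.
  rewrite reducesP -eqDD -eqDD'; split=> [[_]//|[]]; by split.
split=> //; apply/seteqP; split=> [D [cD dl dr]|D [cD QD]]; first by split=> //; exact/MDP.
exact/MDP.
Qed.
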